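(* There is a collection $(P_\alpha:\alpha\in\{0,1\}^{\mathbb{N}})$ of infinite-dimensional orthogonal projections in $\mathcal{B}(\ell_2)$ such that: (1) for any $n\in\mathbb{N}$ and any $\alpha_1,\dots,\alpha_n\in\{0,1\}^{\mathbb{N}}$ there is a nonzero projection $P_{\alpha_1,\dots,\alpha_n}\in\mathcal{B}(\ell_2)$ with $P_{\alpha_1,\dots,\alpha_n}\leq P_{\alpha_i}$ for every $1\le i\le n$; and (2) for every orthonormal basis $(e_k)_{k\in\mathbb{N}}$ of $\ell_2$ there is $\alpha\in\{0,1\}^{\mathbb{N}}$ such that for each $k\in\mathbb{N}$ we have $$|\langle P_\alpha(e_k),e_k\rangle|\leq 19/20.$$
   Context: $\ell_2=\ell_2(\mathbb{N})$ is the complex separable infinite-dimensional Hilbert space and $\mathcal{B}(\ell_2)$ is the algebra of all bounded linear operators on it. $\{0,1\}^{\mathbb{N}}$ is the set of all infinite sequences of zeros and ones. ''Infinite-dimensional'' projection means that its range is infinite-dimensional. For orthogonal projections, $P\le Q$ is the usual order (the range of $P$ is contained in the range of $Q$). *)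

(* Defs.v *)
From HB Require Import structures.
From mathcomp Require Import all_boot all_order all_algebra.
From mathcomp Require Import all_classical all_reals all_analysis.
From mathcomp Require Import complex ring.

Set Implicit Arguments.
Unset Strict Implicit.
Unset Printing Implicit Defensive.

Import Order.TTheory GRing.Theory Num.Theory numFieldNormedType.Exports.

Local Open Scope classical_set_scope.
Local Open Scope complex_scope.
Local Open Scope ring_scope.

Definition abs2 (R : realType) (z : R[i]) : R :=
  ComplexField.Normc.normc z ^+ 2.

Definition square_summable (R : realType) : {pred nat -> R[i]} :=
  mem [set x : nat -> R[i] | cvgn (series (fun n => abs2 (x n)))].

Lemma square_summable_submod_closed (R : realType) :
  submod_closed (@square_summable R).
Proof.
split.
  rewrite inE /= (_ : (fun n => _) = (fun=> 0)).
    rewrite (_ : series _ = (fun=> 0)); first exact: is_cvg_cst.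
    by apply/funext => n; rewrite /series /= big1.
  by apply/funext => n; rewrite /abs2 ComplexField.Normc.normc0 expr0n.
move=> a x y; rewrite !inE /= => hx hy.
have hn (z : R[i]) : 0 <= ComplexField.Normc.normc z.
  by case: z => u v; exact: sqrtr_ge0.
have sq (p q r : R) : 0 <= r -> r <= p + q -> r ^+ 2 <= 2 * (p ^+ 2 + q ^+ 2).
  move=> r0 rpq; apply: (@le_trans _ _ ((p + q) ^+ 2)).
    by rewrite lerXn2r ?nnegrE// (le_trans r0).
  rewrite -subr_ge0 (_ : _ - _ = (p - q) ^+ 2) ?sqr_ge0//.
  by ring.
pose u n := 2 * abs2 a * abs2 (x n) + 2 * abs2 (y n).
apply: (@series_le_cvg _ _ u) => [n|n|n|].
- exact: sqr_ge0.
- by rewrite addr_ge0 ?mulr_ge0 ?sqr_ge0.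
- rewrite /u -mulrA -mulrDr /abs2 -exprMn; apply: sq => //.
  by rewrite -ComplexField.Normc.normcM; exact: le_normcD.
- rewrite (_ : series u = (2 * abs2 a) *: series (fun n => abs2 (x n)) +
                          2 *: series (fun n => abs2 (y n))).
    by apply: is_cvgD; exact: is_cvgZr.
  apply/funext => n; rewrite /series /= /u.
  rewrite big_split /= -!mulr_sumr.
  by [].
Qed.

HB.instance Definition _ (R : realType) :=
  GRing.isSubmodClosed.Build _ _ (@square_summable R)
    (@square_summable_submod_closed R).

Record l2 (R : realType) := L2 {
  l2_seq :> nat -> R[i];
  _ : l2_seq \in @square_summable R }.

HB.instance Definition _ (R : realType) := [isSub for @l2_seq R].
HB.instance Definition _ (R : realType) := [Choice of l2 R by <:].
HB.instance Definition _ (R : realType) :=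
  [SubChoice_isSubLmodule of l2 R by <:].

(* Linear in the first variable. The regular module [R[i]^o] carries the usual
   topology of the complex plane. *)
Definition inner (R : realType) (x y : l2 R) : R[i] :=
  limn (series (fun n => x n * (y n)^*%C : R[i]^o)).

Definition l2norm (R : realType) (x : l2 R) : R :=
  Num.sqrt (limn (series (fun n => abs2 (x n)))).

Definition bounded_op (R : realType) (T : {linear l2 R -> l2 R}) : Prop :=
  exists M : R, forall x, l2norm (T x) <= M * l2norm x.

Definition self_adjoint (R : realType) (T : {linear l2 R -> l2 R}) : Prop :=
  forall x y, inner (T x) y = inner x (T y).

Definition orthogonal_projection (R : realType) (T : {linear l2 R -> l2 R}) :
    Prop :=
  [/\ bounded_op T, forall x, T (T x) = T x & self_adjoint T].

Definition finite_dimensional (R : realType) (V : set (l2 R)) : Prop :=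
  exists (n : nat) (v : 'I_n -> l2 R),
    forall x, V x -> exists c : 'I_n -> R[i], x = \sum_(i < n) c i *: v i.

Definition proj_le (R : realType) (S T : {linear l2 R -> l2 R}) : Prop :=
  range S `<=` range T.

Definition orthonormal (R : realType) (e : nat -> l2 R) : Prop :=
  forall j k, inner (e j) (e k) = (j == k)%:R.

Definition span_dense (R : realType) (e : nat -> l2 R) : Prop :=
  forall (x : l2 R) (eps : R), 0 < eps ->
    exists (n : nat) (c : nat -> R[i]),
      l2norm (x - \sum_(k < n) c k *: e k) < eps.

Definition orthonormal_basis (R : realType) (e : nat -> l2 R) : Prop :=
  orthonormal e /\ span_dense e.

(* Main.v *)
(* Idea. Split (part of) l2 into finite-dimensional blocks H_n, where H_n is the
   tensor power, indexed by the 2^n words s of length n, of a space C^F (x) C^F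
   with F a prime field. Block n of P_alpha projects the factor s = alpha|n onto
   one unit vector, the normalized graph of a polynomial F -> F of degree less
   than d; for pairwise distinct words such projections act on distinct factors,
   so they commute and fix a common product vector. This gives (1), however the
   polynomials are chosen.

   For (2), let alpha code the basis e. Graphs of two distinct polynomials are
   nearly orthogonal, so a vector of H_n can be close to the range of at most one
   of the |F|^d projections available. By Bessel, at most dim(H_n) / eps_n basis
   vectors have squared norm at least eps_n in H_n; as |F|^d exceeds this number,
   some polynomial is good for all of them. The components of squared norm below
   eps_n = 2^-(n+3) are summable to a small number. *)
Require Import Defs.
From HB Require Import structures.
From mathcomp Require Import all_boot all_order all_algebra.
From mathcomp Require Import all_classical all_reals all_analysis.
From mathcomp Require Import complex ring lra.

Import Order.TTheory GRing.Theory Num.Theory numFieldNormedType.Exports.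

Set Implicit Arguments.
Unset Strict Implicit.
Unset Printing Implicit Defensive.

Local Open Scope classical_set_scope.
Local Open Scope complex_scope.
Local Open Scope ring_scope.

(** * The inner product of l2 *)

Lemma abs2E (R : realType) (z : R[i]) :
  abs2 z = complex.Re z ^+ 2 + complex.Im z ^+ 2.
Proof. by case: z => a b; rewrite /abs2 /= sqr_sqrtr// addr_ge0// sqr_ge0. Qed.

Lemma abs2_ge0 (R : realType) (z : R[i]) : 0 <= abs2 z.
Proof. exact: sqr_ge0. Qed.

Lemma abs2M (R : realType) (z w : R[i]) : abs2 (z * w) = abs2 z * abs2 w.
Proof. by rewrite /abs2 ComplexField.Normc.normcM exprMn. Qed.

Lemma abs2_eq0 (R : realType) (z : R[i]) : abs2 z = 0 -> z = 0.
Proof.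
by move/eqP; rewrite sqrf_eq0 => /eqP/ComplexField.Normc.eq0_normc.
Qed.

Lemma conjC_mul (R : realType) (z : R[i]) : z * z^*%C = (abs2 z)%:C.
Proof.
case: z => a b; rewrite abs2E /=; simpc; congr (_ +i* _); ring.
Qed.

Lemma cvg_complex (R : realType) (u : nat -> R[i]) (a b : R) :
  (fun n => complex.Re (u n)) @ \oo --> a ->
  (fun n => complex.Im (u n)) @ \oo --> b ->
  (u : nat -> R[i]^o) @ \oo --> (a +i* b : R[i]^o).
Proof.
move=> ha hb; apply/cvgrPdist_lt => -[e1 e2].
(* Positivity in [R[i]] forces the radius to be real; half of it in each coordinate suffices. *)
rewrite ltcE /= => /andP[/eqP -> e1gt0].
have e20 : 0 < e1 / 2 by rewrite divr_gt0.
move/cvgrPdist_lt : ha => /(_ _ e20) ha; move/cvgrPdist_lt : hb => /(_ _ e20) hb.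
near=> n.
have [ha1 hb1] : `|a - complex.Re (u n)| < e1 / 2 /\ `|b - complex.Im (u n)| < e1 / 2.
  by split; near: n.
case: (u n) ha1 hb1 => c d /= ha1 hb1.
rewrite normc_def /= ltcR.
have -> : e1 = Num.sqrt (e1 ^+ 2) by rewrite sqrtr_sqr gtr0_norm.
rewrite ltr_sqrt ?exprn_gt0//.
rewrite -(real_normK (num_real (a - c))) -(real_normK (num_real (b - d))).
have := normr_ge0 (a - c); have := normr_ge0 (b - d).
nra.
Unshelve. all: by end_near. Qed.

Lemma Re_sum (R : realType) (I : Type) (r : seq I) (P : pred I)
    (F : I -> R[i]) :
  complex.Re (\sum_(i <- r | P i) F i) = \sum_(i <- r | P i) complex.Re (F i).
Proof. by apply: (big_morph (@complex.Re R)) => // -[a b] [c d]. Qed.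

Lemma Im_sum (R : realType) (I : Type) (r : seq I) (P : pred I)
    (F : I -> R[i]) :
  complex.Im (\sum_(i <- r | P i) F i) = \sum_(i <- r | P i) complex.Im (F i).
Proof. by apply: (big_morph (@complex.Im R)) => // -[a b] [c d]. Qed.

Lemma cvg_seriesC (R : realType) (u : nat -> R[i]) (a b : R) :
  series (fun n => complex.Re (u n)) @ \oo --> a ->
  series (fun n => complex.Im (u n)) @ \oo --> b ->
  series (u : nat -> R[i]^o) @ \oo --> (a +i* b : R[i]^o).
Proof.
move=> ha hb; apply: cvg_complex.
  by under eq_fun do rewrite /series /= Re_sum.
by under eq_fun do rewrite /series /= Im_sum.
Qed.

Section L2Theory.
Variable R : realType.
Implicit Types x y : l2 R.

Definition nsq x : R := limn (series (fun n => abs2 (x n))).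

Lemma l2_cvg x : cvgn (series (fun n => abs2 (x n))).
Proof. by have := valP x; rewrite inE. Qed.

Lemma l2D x y n : (x + y) n = x n + y n.
Proof. by []. Qed.

Lemma l2Z (a : R[i]) x n : (a *: x) n = a * x n.
Proof. by []. Qed.

Lemma l2_inj x y : (forall n, x n = y n) -> x = y.
Proof. by move=> h; apply/val_inj/funext. Qed.

(** Comparison: |z w| is at most |z|^2 + |w|^2. The real and imaginary parts are the intended [f],
    so that convergence is settled over [R]. *)
Lemma l2_term_cvg (f : R[i] -> R) x y :
  (forall z, `|f z| ^+ 2 <= abs2 z) ->
  cvgn (series (fun n => f (x n * (y n)^*%C))).
Proof.
move=> hf; apply: normed_cvg.
apply: (@series_le_cvg _ _ (fun n => abs2 (x n) + abs2 (y n))) => [n|n|n|].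
- exact: normr_ge0.
- by rewrite addr_ge0// abs2_ge0.
- have := hf (x n * (y n)^*%C); rewrite abs2M.
  have -> : abs2 (y n)^*%C = abs2 (y n) by rewrite !abs2E; case: (y n) => a b /=; ring.
  have := abs2_ge0 (x n); have := abs2_ge0 (y n); set u := abs2 _; set v := abs2 _.
  have := normr_ge0 (f (x n * (y n)^*%C)); set w := `|_|.
  move=> w0 u0 v0 h; rewrite -(@ler_pXn2r _ 2) ?nnegrE ?addr_ge0//.
  apply: le_trans h _; have := mulr_ge0 u0 v0; have := sqr_ge0 u; have := sqr_ge0 v; nra.
- rewrite (_ : series _ = series (fun n => abs2 (x n)) + series (fun n => abs2 (y n))).
    by apply: is_cvgD; exact: l2_cvg.
  by apply/funext => n; rewrite /series /= big_split.
Qed.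

Lemma Re_inner_cvg x y : cvgn (series (fun n => complex.Re (x n * (y n)^*%C))).
Proof.
by apply: l2_term_cvg => z; rewrite abs2E real_normK ?num_real// lerDl sqr_ge0.
Qed.

Lemma Im_inner_cvg x y : cvgn (series (fun n => complex.Im (x n * (y n)^*%C))).
Proof.
by apply: l2_term_cvg => z; rewrite abs2E real_normK ?num_real// lerDr sqr_ge0.
Qed.

Lemma innerE x y : inner x y =
  limn (series (fun n => complex.Re (x n * (y n)^*%C))) +i*
  limn (series (fun n => complex.Im (x n * (y n)^*%C))).
Proof.
apply: (@cvg_lim (R[i]^o : normedModType R[i])) => //.
exact: cvg_seriesC (@Re_inner_cvg x y) (@Im_inner_cvg x y).
Qed.

Lemma inner_cvg x y :
  series (fun n => x n * (y n)^*%C : R[i]^o) @ \oo --> (inner x y : R[i]^o).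
Proof.
by rewrite innerE; exact: cvg_seriesC (@Re_inner_cvg x y) (@Im_inner_cvg x y).
Qed.

Lemma inner_linear (a : R[i]) x y (z : l2 R) :
  inner (a *: x + y) z = a * inner x z + inner y z.
Proof.
apply: (@cvg_lim (R[i]^o : normedModType R[i])) => //.
rewrite (_ : series _ = (fun n => a *: (series (fun n => x n * (z n)^*%C : R[i]^o) n)
   + series (fun n => y n * (z n)^*%C : R[i]^o) n)).
  by apply: cvgD; [apply: cvgZr|]; exact: inner_cvg.
apply/funext => n; rewrite /series /= scaler_sumr -big_split /=.
by apply: eq_bigr => i _; rewrite [X in X * _ = _](_ : _ = a * x i + y i)// mulrDl -mulrA.
Qed.

Lemma innerC x y : inner y x = (inner x y)^*%C.
Proof.
rewrite !innerE /=; congr (_ +i* _).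
  congr (limn (series _)); apply/funext => n.
  by case: (x n) (y n) => [a b] [c d] /=; ring.
rewrite -limN.
  congr (limn _); apply/funext => n; rewrite opprfctE /series /= -sumrN.
  apply: eq_bigr => i _.
  by case: (x i) (y i) => [a b] [c d] /=; ring.
exact: Im_inner_cvg.
Qed.

Lemma inner_xx x : inner x x = (nsq x)%:C.
Proof.
rewrite innerE /nsq; congr (_ +i* _).
  by congr (limn (series _)); apply/funext => n; rewrite conjC_mul.
rewrite (_ : series _ = fun=> 0) ?lim_cst//.
by apply/funext => n; rewrite /series /= big1// => i _; rewrite conjC_mul.
Qed.

Lemma l2normE x : l2norm x = Num.sqrt (nsq x).
Proof. by []. Qed.

Lemma nsq_ge n x : \sum_(0 <= k < n) abs2 (x k) <= nsq x.
Proof.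
apply: (@nondecreasing_cvgn_le _ (series (fun n => abs2 (x n))) _ _ n); last exact: l2_cvg.
by apply/nondecreasing_seqP => m; rewrite /series /= big_nat_recr//= lerDl abs2_ge0.
Qed.

Lemma nsq_ge0 x : 0 <= nsq x.
Proof. by have := nsq_ge 0 x; rewrite big_geq. Qed.

Lemma nsq_le x (r : R) : (forall n, \sum_(0 <= k < n) abs2 (x k) <= r) -> nsq x <= r.
Proof. by move=> h; apply: limr_le; [exact: l2_cvg|apply: nearW]. Qed.

Lemma square_summable_le (u : nat -> R[i]) (r : R) :
  (forall n, \sum_(0 <= k < n) abs2 (u k) <= r) -> u \in @square_summable R.
Proof.
move=> h; rewrite inE /=; apply: nondecreasing_is_cvgn.
  by apply/nondecreasing_seqP => m; rewrite /series /= big_nat_recr//= lerDl abs2_ge0.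
by exists r => _ [n _ <-]; exact: h.
Qed.

End L2Theory.

(** * Sesquilinearity, contractive idempotents and Bessel's inequality *)

Section InnerProduct.
Variable R : realType.
Implicit Types (x y z : l2 R) (a : R[i]).

Lemma innerDl x y z : inner (x + y) z = inner x z + inner y z.
Proof. by have := inner_linear 1 x y z; rewrite scale1r mul1r. Qed.

Lemma inner0l y : inner 0 y = 0.
Proof. by apply: (addrI (inner 0 y)); rewrite -innerDl !addr0. Qed.

Lemma innerZl a x y : inner (a *: x) y = a * inner x y.
Proof. by rewrite -[a *: x]addr0 inner_linear inner0l addr0. Qed.

Lemma innerNl x y : inner (- x) y = - inner x y.
Proof. by rewrite -scaleN1r innerZl mulN1r. Qed.

Lemma innerDr x y z : inner z (x + y) = inner z x + inner z y.
Proof. by rewrite innerC innerDl rmorphD/= -!innerC. Qed.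

Lemma innerZr a x y : inner y (a *: x) = a^*%C * inner y x.
Proof. by rewrite innerC innerZl rmorphM/= -innerC. Qed.

Lemma innerNr x y : inner y (- x) = - inner y x.
Proof. by rewrite innerC innerNl rmorphN/= -innerC. Qed.

Lemma inner_suml (I : Type) (s : seq I) (F : I -> l2 R) y :
  inner (\sum_(i <- s) F i) y = \sum_(i <- s) inner (F i) y.
Proof.
by apply: (big_morph (fun x => inner x y)) => [? ?|]; rewrite ?innerDl ?inner0l.
Qed.

Lemma nsqD x y : nsq (x + y) = nsq x + nsq y + 2 * complex.Re (inner x y).
Proof.
have := inner_xx (x + y).
rewrite innerDl !innerDr !inner_xx (innerC x y).
case: (inner x y) => u v; simpc => -[<-] /=; ring.
Qed.

Lemma nsqZ a x : nsq (a *: x) = abs2 a * nsq x.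
Proof.
have := inner_xx (a *: x).
rewrite innerZl innerZr mulrA conjC_mul inner_xx -rmorphM.
by case=> ->.
Qed.

(** [T] fixes [T x] and kills [y - T y]. By contractivity, adding a multiple of the second to the
    first cannot shorten it, which forces orthogonality. *)
Lemma contraction_idempotent_orthogonal (T : {linear l2 R -> l2 R}) x y :
  (forall x, nsq (T x) <= nsq x) -> (forall x, T (T x) = T x) ->
  inner (T x) (y - T y) = 0.
Proof.
move=> Tle TT; set u := T x; set v := y - T y; set z := inner u v.
have Tv : T v = 0 by rewrite /v linearB/= TT subrr.
have v0 := nsq_ge0 v.
(* This gives [s * nsq v = 1 - s], which is less than 2, so moving [u] by [- s z] along [v] would
   strictly shorten it unless [z] is 0. The summand 1 covers [v = 0]. *)
pose s := (1 + nsq v)^-1.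
have s0 : 0 < s by rewrite invr_gt0 ltr_pwDl.
have := Tle (u + (- (s%:C * z)) *: v).
rewrite linearD linearZ/= Tv scaler0 addr0 TT -/u nsqD nsqZ innerZr -/z.
have -> : complex.Re ((- (s%:C * z))^*%C * z) = - s * abs2 z.
  by rewrite abs2E; case: (z) => p q /=; ring.
have -> : abs2 (- (s%:C * z)) = s ^+ 2 * abs2 z.
  by rewrite !abs2E; case: (z) => p q /=; ring.
move=> h; apply: abs2_eq0; apply/eqP; rewrite eq_le abs2_ge0 andbT.
have sv : s * nsq v = 1 - s.
  by rewrite /s; field; rewrite gt_eqF// ltr_pwDl.
have {}h : 0 <= s * (abs2 z * (s * nsq v - 2)) by move: h; rewrite -subr_ge0; nra.
move: h; rewrite pmulr_rge0// sv => h.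
have := abs2_ge0 z; nra.
Qed.

(** Self-adjointness holds because both sides equal [inner (T x) (T y)]. The averaging operators
    below thus need only a norm bound and idempotence. *)
Lemma contraction_idempotent_projection (T : {linear l2 R -> l2 R}) :
  (forall x, nsq (T x) <= nsq x) -> (forall x, T (T x) = T x) ->
  orthogonal_projection T.
Proof.
move=> Tle TT; split=> //.
  by exists 1 => x; rewrite mul1r !l2normE ler_wsqrtr.
have key x y : inner (T x) y = inner (T x) (T y).
  apply/eqP; rewrite -subr_eq0 -innerNr -innerDr.
  by rewrite contraction_idempotent_orthogonal.
by move=> x y; rewrite key innerC -key -innerC.
Qed.

(** For the partial expansion [p] of [x], both [nsq p] and [inner p x] equal the sum, so the claim
    is that x - p has nonnegative squared norm. *)
Lemma bessel (e : nat -> l2 R) (s : seq nat) x :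
  Defs.orthonormal e -> uniq s -> \sum_(k <- s) abs2 (inner x (e k)) <= nsq x.
Proof.
move=> eo us; pose c k := inner x (e k); pose p := \sum_(k <- s) c k *: e k.
have pe k : k \in s -> inner p (e k) = c k.
  move=> ks; rewrite inner_suml (bigD1_seq k)//= innerZl eo eqxx mulr1.
  by rewrite big1 ?addr0// => j jk; rewrite innerZl eo (negbTE jk) mulr0.
have px y : inner p y = \sum_(k <- s) c k * (inner y (e k))^*%C.
  by rewrite inner_suml; apply: eq_bigr => k _; rewrite innerZl -innerC.
have sumE : inner p x = (\sum_(k <- s) abs2 (c k))%:C.
  rewrite px rmorph_sum/=; apply: eq_bigr => k _; rewrite -/(c k).
  by rewrite conjC_mul.
have pp : nsq p = \sum_(k <- s) abs2 (c k).
  have := inner_xx p; rewrite px (_ : \sum_(k <- s) _ = (\sum_(k <- s) abs2 (c k))%:C).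
    by case.
  rewrite rmorph_sum/= !big_seq; apply: eq_bigr => k ks.
  by rewrite pe// conjC_mul.
have := nsq_ge0 (- p + x).
rewrite nsqD innerNl sumE -scaleN1r nsqZ pp.
have -> : abs2 (-1 : R[i]) = 1 by rewrite abs2E/=; ring.
by rewrite /=; lra.
Qed.

End InnerProduct.

(** * Finitely supported indicator vectors and coordinates *)

Section Indicator.
Variable R : realType.

Definition indic_seq (s : seq nat) : nat -> R[i] := fun j => (j \in s)%:R.

Lemma indic_summable s n :
  \sum_(0 <= k < n) abs2 (indic_seq s k) <= (size s)%:R.
Proof.
rewrite (eq_bigr (fun k => if k \in s then 1 else 0)); last first.
  by move=> k _; rewrite abs2E /indic_seq; case: ifP => _ /=; ring.
rewrite -big_mkcond /= -big_filter big_const_seq count_predT iter_addr_0 ler_nat.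
apply: uniq_leq_size; first by rewrite filter_uniq ?iota_uniq.
by move=> k; rewrite mem_filter => /andP[].
Qed.

Definition indic (s : seq nat) : l2 R :=
  L2 (square_summable_le (@indic_summable s)).

Lemma indicE s j : indic s j = (j \in s)%:R.
Proof. by []. Qed.

Lemma inner_indic1 (x : l2 R) j : inner x (indic [:: j]) = x j.
Proof.
apply: (@cvg_lim (R[i]^o : normedModType R[i])) => //; apply: cvg_near_cst.
near=> n; rewrite /series /= (bigD1_seq j) ?iota_uniq//=; last first.
  by rewrite mem_index_iota /=; near: n; exact: nbhs_infty_gt.
rewrite /indic_seq mem_head conjc1 mulr1 big1 ?addr0// => i ij.
by rewrite inE (negbTE ij) conjc0 mulr0.
Unshelve. all: by end_near. Qed.

(** Bessel's inequality for the unit vector [indic [:: j]], whose inner products with the [e k] are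
    the conjugates of their coordinates at [j]. *)
Lemma bessel_coord (e : nat -> l2 R) (s : seq nat) j :
  Defs.orthonormal e -> uniq s -> \sum_(k <- s) abs2 (e k j) <= 1.
Proof.
move=> eo us; apply: le_trans (_ : nsq (indic [:: j]) <= 1); last first.
  by apply: nsq_le => n; exact: indic_summable.
apply: le_trans (bessel _ eo us); apply: ler_sum => k _.
rewrite innerC inner_indic1 !abs2E; case: (e k j) => a b /=.
by rewrite sqrrN.
Qed.

End Indicator.

(** * Block averaging projections *)

(** Nonnegativity of the variance: expand the squared deviations from the mean [S / n]. *)
Lemma sqr_sum_le (R : realFieldType) (I : finType) (A : {set I}) (F : I -> R) :
  (\sum_(i in A) F i) ^+ 2 <= #|A|%:R * \sum_(i in A) F i ^+ 2.
Proof.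
have [->|A0] := eqVneq A finset.set0; first by rewrite !big_set0 expr0n mulr0.
have n0 : 0 < #|A|%:R :> R by rewrite ltr0n card_gt0.
set n : R := #|A|%:R in n0 *; set S := \sum_(i in A) F i.
have : 0 <= \sum_(i in A) (F i - S / n) ^+ 2 by apply: sumr_ge0 => i _; exact: sqr_ge0.
rewrite (eq_bigr (fun i => F i ^+ 2 + (- (2 * S / n) * F i + (S / n) ^+ 2))); last first.
  by move=> i _; ring.
rewrite !big_split /= -mulr_sumr -/S sumr_const -[_ *+ #|A|]mulr_natl -/n.
set Q := \sum_(i in A) F i ^+ 2.
have -> : Q + (- (2 * S / n) * S + n * (S / n) ^+ 2) = (n * Q - S ^+ 2) / n.
  by field; rewrite gt_eqF.
by rewrite pmulr_lge0 ?invr_gt0// subr_ge0.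
Qed.

Lemma abs2_sum_le (R : realType) (I : finType) (A : {set I}) (F : I -> R[i]) :
  abs2 (\sum_(i in A) F i) <= #|A|%:R * \sum_(i in A) abs2 (F i).
Proof.
rewrite abs2E Re_sum Im_sum (eq_bigr _ (fun i _ => abs2E (F i))) big_split/= mulrDr.
by rewrite lerD// sqr_sum_le.
Qed.

Lemma sum_uniq_le (R : numDomainType) (I : eqType) (s1 s2 : seq I) (g : I -> R) :
  uniq s1 -> uniq s2 -> (forall i, 0 <= g i) ->
  (forall i, i \in s1 -> i \in s2 \/ g i = 0) ->
  \sum_(i <- s1) g i <= \sum_(i <- s2) g i.
Proof.
move=> u1 u2 g0 h; rewrite (bigID (mem s2)) /=.
rewrite [X in _ + X]big_seq_cond [X in _ + X]big1 ?addr0; last first.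
  by move=> i /andP[i1 /negP i2]; case: (h i i1).
rewrite -big_filter (perm_big [seq i <- s2 | i \in s1]); last first.
  apply: uniq_perm; rewrite ?filter_uniq// => i.
  by rewrite !mem_filter andbC.
rewrite big_filter [leRHS](bigID (mem s1)) /= lerDl sumr_ge0//.
Qed.

Section Blocks.
Variables (R : realType) (X : nat -> finType).
Implicit Types (u : nat -> R[i]) (x : l2 R) (m : nat).

Notation T := {n : nat & X n}.
Notation cell := (forall m : nat, X m -> {set X m}).

(** Pickling the disjoint union places the blocks on disjoint sets of coordinates. Integers that are
    not codes belong to no block; the averages below vanish there. *)
Definition idx m (h : X m) : nat := pickle (Tagged X h : T).

Lemma idx_inj m : injective (@idx m).
Proof.
by move=> h h' /(pcan_inj pickleK)/eqP; rewrite eq_Tagged /= => /eqP.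
Qed.

Lemma idx_tag m m' (h : X m) (h' : X m') : idx h = idx h' -> m = m'.
Proof. by move=> /(pcan_inj pickleK)/(congr1 tag). Qed.

Lemma idxP j : (exists m (h : X m), j = idx h) \/ @pickle_inv T j = None.
Proof.
have := @pickle_invK T j; case: pickle_inv => [[m h]|]; last by right.
by left; exists m, h.
Qed.

Definition block_idx M : seq nat :=
  [seq pickle t | t <- [seq Tagged X h : T | m <- iota 0 M, h <- enum (X m)]].

Lemma block_idx_uniq M : uniq (block_idx M).
Proof.
rewrite map_inj_uniq; last exact: (pcan_inj pickleK).
apply: allpairs_uniq_dep => [|m _|]; [exact: iota_uniq|exact: enum_uniq|].
by case=> [m h] [m' h'] _ _ /=.
Qed.

Lemma sum_block_idx M (g : nat -> R) :
  \sum_(j <- block_idx M) g j = \sum_(0 <= m < M) \sum_(h : X m) g (idx h).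
Proof.
rewrite big_map big_allpairs_dep /= /index_iota subn0; apply: eq_bigr => m _.
by rewrite big_enum.
Qed.

Lemma sum_le_blocks N (g : nat -> R) :
  (forall j, 0 <= g j) -> (forall j, @pickle_inv T j = None -> g j = 0) ->
  exists M, \sum_(0 <= j < N) g j <= \sum_(0 <= m < M) \sum_(h : X m) g (idx h).
Proof.
move=> g0 gN.
(* One more than every block number met below [N]; the default 0 for non-codes is harmless in a
   maximum. *)
pose M := (\max_(j < N) if @pickle_inv T j is Some t then tag t else 0).+1.
exists M; rewrite -sum_block_idx; apply: sum_uniq_le => //.
- exact: iota_uniq.
- exact: block_idx_uniq.
move=> j; rewrite mem_index_iota /= => jN.
have [[m [h jE]]|/gN] := idxP j; last by right.
left; rewrite jE; apply: map_f; apply/allpairsPdep; exists m, h; split=> //.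
  rewrite mem_iota /= add0n ltnS; apply: leq_trans (leq_bigmax (Ordinal jN)).
  by rewrite /= jE pickleK_inv.
by rewrite mem_enum.
Qed.

Lemma sum_blocks_le M (g : nat -> R) :
  (forall j, 0 <= g j) ->
  exists N, \sum_(0 <= m < M) \sum_(h : X m) g (idx h) <= \sum_(0 <= j < N) g j.
Proof.
move=> g0; exists (\max_(j <- block_idx M) j).+1.
rewrite -sum_block_idx; apply: sum_uniq_le => //.
- exact: block_idx_uniq.
- exact: iota_uniq.
move=> j jM; left; rewrite mem_index_iota /= ltnS.
by rewrite (big_rem j) //= leq_maxl.
Qed.

Definition blocknsq u m : R := \sum_(h : X m) abs2 (u (idx h)).

Lemma blocknsq_nsq M x : \sum_(0 <= m < M) blocknsq x m <= nsq x.
Proof.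
have [N h] := @sum_blocks_le M (fun j => abs2 (x j)) (fun j => abs2_ge0 _).
exact: le_trans h (nsq_ge N x).
Qed.

Lemma blocknsq_sum_le u (r : R) N :
  (forall j, @pickle_inv T j = None -> u j = 0) ->
  (forall M, \sum_(0 <= m < M) blocknsq u m <= r) ->
  \sum_(0 <= j < N) abs2 (u j) <= r.
Proof.
move=> u0 ur.
have [|j jN|M h] := @sum_le_blocks N (fun j => abs2 (u j)).
- by move=> j; exact: abs2_ge0.
- by rewrite /= u0// abs2E /=; ring.
exact: le_trans h (ur M).
Qed.

(** [B m h] is meant as the cell containing [h], empty when there is none; in that case the sum is
    empty and the value is 0. *)
Definition avg (B : cell) u j : R[i] :=
  if @pickle_inv T j is Some t
  then (#|B (tag t) (tagged t)|%:R)^-1 * \sum_(h in B (tag t) (tagged t)) u (idx h)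
  else 0.

Lemma avg_idx B u m (h : X m) :
  avg B u (idx h) = (#|B m h|%:R)^-1 * \sum_(h' in B m h) u (idx h').
Proof. by rewrite /avg pickleK_inv. Qed.

(** A nonempty cell contains its index, and two cells that meet coincide. Empty cells mark the
    points where the projection vanishes. *)
Definition partial_partition (B : cell) : Prop :=
  forall m (h h' : X m), h' \in B m h -> h \in B m h /\ B m h' = B m h.

Lemma abs2_natV n : abs2 ((n%:R)^-1 : R[i]) = (n%:R ^- 2 : R).
Proof.
have -> : (n%:R)^-1 = ((n%:R)^-1)%:C :> R[i] by rewrite fmorphV rmorph_nat.
by rewrite abs2E /= exprVn; ring.
Qed.

(** Cauchy-Schwarz on each cell; after exchanging the sums, [h'] has total weight 1 if it lies in a
    cell and 0 otherwise. *)
Lemma blocknsq_avg B u m : partial_partition B ->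
  blocknsq (avg B u) m <= blocknsq u m.
Proof.
move=> hB; rewrite /blocknsq.
pose w (h : X m) : R := (#|B m h|%:R)^-1.
have w0 h : 0 <= w h by rewrite invr_ge0.
apply: (@le_trans _ _ (\sum_h \sum_(h' in B m h) w h * abs2 (u (idx h')))).
  apply: ler_sum => h _; rewrite avg_idx abs2M abs2_natV -mulr_sumr.
  apply: le_trans (ler_wpM2l _ (abs2_sum_le _ _)) _; first by rewrite invr_ge0 sqr_ge0.
  rewrite mulrA -/(w h) ler_wpM2r ?sumr_ge0// => [i _|]; first exact: abs2_ge0.
  have [->|B0] := eqVneq #|B m h| 0%N; first by rewrite mulr0 invr_ge0.
  by rewrite expr2 invfM -mulrA mulVf ?mulr1// pnatr_eq0.
rewrite (exchange_big_dep xpredT)//=; apply: ler_sum => h' _.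
rewrite -mulr_suml ler_piMl ?abs2_ge0//.
have sym h : (h' \in B m h) = (h \in B m h').
  by apply/idP/idP => /[dup] /hB[hh ->].
rewrite (eq_big (mem (B m h')) (fun=> w h')) => [|h|h /hB[_ e]].
- rewrite sumr_const -mulr_natl /w.
  have [->|B0] := eqVneq #|B m h'| 0%N; first by rewrite mul0r.
  by rewrite mulfV// pnatr_eq0.
- exact: sym.
- by rewrite /w e.
Qed.

Lemma avg_notin B u j : @pickle_inv T j = None -> avg B u j = 0.
Proof. by rewrite /avg => ->. Qed.

Lemma avg_sum_le B x n : partial_partition B ->
  \sum_(0 <= j < n) abs2 (avg B x j) <= nsq x.
Proof.
move=> hB; apply: blocknsq_sum_le => [j|M]; first exact: avg_notin.
apply: le_trans (blocknsq_nsq M x); apply: ler_sum => m _.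
exact: blocknsq_avg.
Qed.

Definition avg_op B (hB : partial_partition B) x : l2 R :=
  L2 (square_summable_le (fun n => avg_sum_le x n hB)).

Lemma avg_opE B (hB : partial_partition B) x j : avg_op hB x j = avg B x j.
Proof. by []. Qed.

Lemma avg_op_linear B (hB : partial_partition B) : linear (avg_op hB).
Proof.
move=> a x y; apply: l2_inj => j; rewrite l2D l2Z !avg_opE /avg.
case: pickle_inv => [t|]; last by rewrite mulr0 addr0.
by rewrite mulrCA -mulrDr; congr (_ * _); rewrite mulr_sumr -big_split.
Qed.

HB.instance Definition _ B (hB : partial_partition B) :=
  GRing.isLinear.Build R[i] (l2 R) (l2 R) *:%R (avg_op hB) (avg_op_linear hB).

(** The hypotheses make [avg D u] constant on the cells of [B] and zero off them, hence fixed by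
    [avg B]. With [D = B] this is idempotence; in general it gives an inclusion of ranges. *)
Lemma avg_absorb (B D : cell) u :
  (forall m (h h' : X m), h' \in B m h -> D m h' = D m h) ->
  (forall m (h : X m), B m h = finset.set0 -> D m h = finset.set0) ->
  avg B (avg D u) = avg D u.
Proof.
move=> BD B0; apply/funext => j.
have [[m [h ->]]|j0] := idxP j; last by rewrite !avg_notin.
rewrite avg_idx.
have [Bh|Bh] := eqVneq (B m h) finset.set0.
  by rewrite avg_idx Bh (B0 _ _ Bh) !big_set0 !mulr0.
rewrite (eq_bigr (fun=> avg D u (idx h))) => [|h' h'B]; last first.
  by rewrite !avg_idx (BD _ _ _ h'B).
rewrite sumr_const -[avg D u _ *+ _]mulr_natl mulrA mulVf ?mul1r//.
by rewrite pnatr_eq0 -lt0n card_gt0.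
Qed.

Lemma avg_op_absorb (B D : cell) (hB : partial_partition B)
    (hD : partial_partition D) x :
  (forall m (h h' : X m), h' \in B m h -> D m h' = D m h) ->
  (forall m (h : X m), B m h = finset.set0 -> D m h = finset.set0) ->
  avg_op hB (avg_op hD x) = avg_op hD x.
Proof. by move=> BD B0; apply: l2_inj => j; rewrite avg_opE avg_absorb. Qed.

Lemma avg_op_idem B (hB : partial_partition B) x :
  avg_op hB (avg_op hB x) = avg_op hB x.
Proof. by apply: avg_op_absorb => // m h h' /hB[]. Qed.

Lemma avg_op_projection B (hB : partial_partition B) :
  orthogonal_projection (avg_op hB).
Proof.
apply: contraction_idempotent_projection => x; last exact: avg_op_idem.
by apply: nsq_le => n; exact: avg_sum_le.
Qed.

Definition cell_indic m (A : {set X m}) : l2 R := indic R [seq idx h | h <- enum A].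

Lemma cell_indicE m (A : {set X m}) (h : X m) : cell_indic A (idx h) = (h \in A)%:R.
Proof.
by rewrite /cell_indic indicE mem_map ?mem_enum//; exact: idx_inj.
Qed.

Lemma cell_indic_neq m m' (A : {set X m}) (h : X m') :
  m != m' -> cell_indic A (idx h) = 0.
Proof.
move=> mm'; rewrite /cell_indic indicE; case: mapP => // -[h0 _ /idx_tag e].
by rewrite e eqxx in mm'.
Qed.

Lemma avg_op_cell_indic B (hB : partial_partition B) m (h : X m) :
  avg_op hB (cell_indic (B m h)) = cell_indic (B m h).
Proof.
apply: l2_inj => j; rewrite avg_opE.
have [[m' [h' ->]]|j0] := idxP j; last first.
  rewrite avg_notin// /cell_indic indicE; case: mapP => // -[h0 _ e].
  by rewrite e pickleK_inv in j0.
rewrite avg_idx; have [e|mm'] := eqVneq m m'; last first.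
  by rewrite cell_indic_neq// big1 ?mulr0// => ? _; rewrite cell_indic_neq.
subst m'; rewrite cell_indicE.
have [Bh'|Bh'] := eqVneq (B m h') finset.set0.
  rewrite Bh' big_set0 mulr0; case: (boolP (h' \in _)) => // /[dup] h'B /hB[hB' e].
  by rewrite -e Bh' inE in hB'.
rewrite (eq_bigr (fun=> (h' \in B m h)%:R)) => [|h0 h0B]; last first.
  rewrite cell_indicE; congr (_ %:R : R[i]); congr nat_of_bool.
  have [h'0 e0] := hB _ _ _ h0B.
  by apply/idP/idP => /[dup] /hB[] a b c; rewrite -b ?e0// -e0 b.
rewrite sumr_const -[(_ \in _)%:R *+ _]mulr_natl mulrA mulVf ?mul1r//.
by rewrite pnatr_eq0 -lt0n card_gt0.
Qed.

(** Every block contributes the indicator of a cell, fixed by the operator. If [n] vectors spanned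
    the range, [n.+1] such indicators would factor an identity matrix of size [n.+1] through rank
    [n]. *)
Lemma avg_op_infinite B (hB : partial_partition B) :
  (forall m, exists h : X m, h \in B m h) ->
  ~ finite_dimensional (range (avg_op hB)).
Proof.
move=> hB0 [n [v vP]].
pose h m := sval (cid (hB0 m)); have hh m : h m \in B m (h m) := svalP (cid (hB0 m)).
have /boolp.choice[c cP] (k : 'I_n.+1) : exists c : 'I_n -> R[i],
    cell_indic (B k (h k)) = \sum_(i < n) c i *: v i.
  by apply: vP; exists (cell_indic (B k (h k))); rewrite ?avg_op_cell_indic.
pose C := \matrix_(k < n.+1, i < n) c k i.
(* Evaluation at one point of each chosen cell, where the indicators form the identity matrix. *)
pose V := \matrix_(i < n, k < n.+1) v i (idx (h k)).
have CV : C *m V = 1%:M.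
  apply/matrixP => k l; rewrite !mxE.
  transitivity (cell_indic (B k (h k)) (idx (h l))).
    rewrite cP; under eq_bigr do rewrite !mxE.
    by elim/big_rec2: _ => [//|i x y _ ->]; rewrite l2D l2Z.
  have [->|kl] := eqVneq k l; first by rewrite cell_indicE hh.
  by rewrite cell_indic_neq.
have := mxrankM_maxl C V; rewrite CV mxrank1 => /leq_trans/(_ (rank_leq_col C)).
by rewrite ltnn.
Qed.

End Blocks.

(** * Averaging over graphs in one tensor factor *)

Section Graphs.
Variables (R : realType) (S F : finType).
Implicit Types (s : S) (f g : F -> F).
Local Open Scope set_scope.

Notation X := {ffun S -> F * F}.

Definition upd (h : X) s (v : F * F) : X := [ffun t => if t == s then v else h t].

Lemma upd_upd h s v w : upd (upd h s v) s w = upd h s w.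
Proof. by apply/ffunP => t; rewrite !ffunE; case: eqP. Qed.

Lemma upd_same h s v : upd h s v s = v.
Proof. by rewrite ffunE eqxx. Qed.

Lemma upd_id h s : upd h s (h s) = h.
Proof. by apply/ffunP => t; rewrite ffunE; case: eqP => [->|]. Qed.

(* Reindex by the involution [(h, v) |-> (upd h s v, h s)]. *)
Lemma sum_upd s (G : X -> R) :
  \sum_h \sum_v G (upd h s v) = #|{: F * F}|%:R * \sum_h G h.
Proof.
rewrite pair_bigA /=.
pose i (hv : X * (F * F)) := (upd hv.1 s hv.2, hv.1 s).
have iK : involutive i.
  by case=> h v; rewrite /i /= upd_upd upd_id upd_same.
rewrite (reindex_inj (inv_inj iK)) /=.
under eq_bigr do rewrite upd_upd upd_id.
rewrite -(pair_bigA _ (fun h v => G h)) /= mulr_sumr.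
by apply: eq_bigr => h _; rewrite sumr_const mulr_natl.
Qed.

(** Averaging over these cells is the rank-one projection onto the normalized graph of [f] in the
    factor [s], tensored with the identity on the other factors. *)
Definition graph_cell f s (h : X) : {set X} :=
  if (h s).2 == f (h s).1 then [set upd h s (a, f a) | a : F] else finset.set0.

Lemma graph_cell_upd f s h a :
  graph_cell f s (upd h s (a, f a)) = [set upd h s (b, f b) | b : F].
Proof.
rewrite /graph_cell upd_same /= eqxx; apply: eq_imset => b.
by rewrite upd_upd.
Qed.

Lemma graph_cell_mem f s h : (h \in graph_cell f s h) = ((h s).2 == f (h s).1).
Proof.
rewrite /graph_cell; case: eqP => [e|]; last by rewrite inE.
by apply/imsetP; exists (h s).1 => //; rewrite -e -surjective_pairing upd_id.
Qed.

Lemma graph_cellP f s h h' : h' \in graph_cell f s h ->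
  h \in graph_cell f s h /\ graph_cell f s h' = graph_cell f s h.
Proof.
move=> h'h; rewrite graph_cell_mem; move: h'h; rewrite {1 3}/graph_cell.
case: ifP => [_|]; last by rewrite inE.
by case/imsetP => a _ ->; rewrite graph_cell_upd.
Qed.

Lemma graph_cell_sum (V : zmodType) f s h (u : X -> V) :
  \sum_(h' in [set upd h s (b, f b) | b : F]) u h' = \sum_a u (upd h s (a, f a)).
Proof.
rewrite big_imset /=; first by apply: eq_bigl => a; rewrite inE.
by move=> a b _ _ /(congr1 (fun h' : X => h' s)); rewrite !upd_same => -[].
Qed.

Lemma graph_cell_card f s h : #|[set upd h s (b, f b) | b : F]| = #|F|.
Proof.
rewrite card_imset ?cardsT// => a b /(congr1 (fun h' : X => h' s)).
by rewrite !upd_same => -[].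
Qed.

Definition graph_avg f s (u : X -> R[i]) h : R[i] :=
  (#|graph_cell f s h|%:R)^-1 * \sum_(h' in graph_cell f s h) u h'.

(** Reduces the norm to fibres along the factor [s], where only a function on the plane [F * F]
    remains; [sum_upd] accounts for the repeated counting of fibres. *)
Lemma graph_avg_nsq f s (u : X -> R[i]) : (0 < #|F|)%N ->
  \sum_h abs2 (graph_avg f s u h) =
  (#|{: F * F}|%:R)^-1 *
    \sum_h ((#|F|%:R)^-1 * abs2 (\sum_a u (upd h s (a, f a)))).
Proof.
move=> F0; have F0' : #|F|%:R != 0 :> R by rewrite pnatr_eq0 -lt0n.
apply: (mulfI (x := #|{: F * F}|%:R)); first by rewrite card_prod natrM mulf_neq0.
rewrite mulVKf; last by rewrite card_prod natrM mulf_neq0.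
rewrite -(sum_upd s); apply: eq_bigr => h _.
rewrite (eq_bigr (fun v => abs2 (graph_avg f s u (upd h s (v.1, v.2))))); last by case.
rewrite -(pair_bigA _ (fun a b => abs2 (graph_avg f s u (upd h s (a, b))))) /=.
(* Over each [a] only the point with second coordinate [f a] has a nonempty cell. *)
transitivity (\sum_(a : F) (#|F|%:R ^- 2 * abs2 (\sum_a u (upd h s (a, f a))) : R)).
  apply: eq_bigr => a _; rewrite (bigD1 (f a))//= big1 => [|b /negbTE bfa]; last first.
    by rewrite /graph_avg /graph_cell upd_same /= bfa big_set0 mulr0 abs2E /=; ring.
  by rewrite addr0 /graph_avg graph_cell_upd graph_cell_card graph_cell_sum abs2M abs2_natV.
rewrite sumr_const -[_ * abs2 _ *+ _]mulr_natl mulrA; congr (_ * _).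
by rewrite expr2 invfM mulrA mulfV// mul1r.
Qed.

(** Near-orthogonality of two graphs: they share at most a quarter of their points and are disjoint
    elsewhere. What matters is that 3/2 is below the trivial 2. *)
Lemma graph_pair_le f g (y : F * F -> R[i]) :
  (4 * #|[set a | f a == g a]| <= #|F|)%N ->
  abs2 (\sum_a y (a, f a)) + abs2 (\sum_a y (a, g a)) <=
  3 / 2 * #|F|%:R * \sum_v abs2 (y v).
Proof.
set E := [set a | _] => cE.
have hE : #|E|%:R <= #|F|%:R / 4 :> R.
  by rewrite ler_pdivlMr// -natrM ler_nat mulnC.
have hC : #|~: E|%:R <= #|F|%:R :> R by rewrite ler_nat max_card.
have split f' : \sum_a y (a, f' a) =
    \sum_(a in E) y (a, f' a) + \sum_(a in ~: E) y (a, f' a).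
  rewrite (bigID (mem E)) /=; congr (_ + _).
  by apply: eq_bigl => a; rewrite finset.in_setC.
(* The weights balance: the shared part enters twice with 3 * 1/4, which makes 3/2, and each
   disjoint part enters once with 3/2. *)
have young (z w : R[i]) : abs2 (z + w) <= 3 * abs2 z + 3 / 2 * abs2 w.
  rewrite !abs2E; case: z w => [a b] [c d] /=.
  have := sqr_ge0 (2 * a - c); have := sqr_ge0 (2 * b - d); nra.
pose XE := \sum_(a in E) abs2 (y (a, f a)).
pose Xc f' := \sum_(a in ~: E) abs2 (y (a, f' a)).
have eg : \sum_(a in E) y (a, g a) = \sum_(a in E) y (a, f a).
  by apply: eq_bigr => a; rewrite inE => /eqP ->.
have XE0 : 0 <= XE by apply: sumr_ge0 => a _; exact: abs2_ge0.
have Xc0 f' : 0 <= Xc f' by apply: sumr_ge0 => a _; exact: abs2_ge0.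
have bE : abs2 (\sum_(a in E) y (a, f a)) <= #|F|%:R / 4 * XE.
  exact: (le_trans (abs2_sum_le _ _) (ler_wpM2r XE0 hE)).
have bC f' : abs2 (\sum_(a in ~: E) y (a, f' a)) <= #|F|%:R * Xc f'.
  exact: (le_trans (abs2_sum_le _ _) (ler_wpM2r (Xc0 f') hC)).
have tot : XE + Xc f + Xc g <= \sum_v abs2 (y v).
  rewrite (eq_bigr (fun v => abs2 (y (v.1, v.2)))); last by case.
  rewrite -(pair_bigA _ (fun a b => abs2 (y (a, b)))) /= (bigID (mem E)) /=.
  rewrite -addrA lerD//.
    apply: ler_sum => a _; rewrite (bigD1 (f a))//= lerDl.
    by apply: sumr_ge0 => b _; exact: abs2_ge0.
  rewrite -big_split /= (eq_bigl (fun a => a \notin E)) => [|a]; last by rewrite finset.in_setC.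
  (* Off [E] the points [(a, f a)] and [(a, g a)] are distinct, so both terms can be extracted from
     the sum over the column of [a]. *)
  apply: ler_sum => a; rewrite inE => fga.
  rewrite (bigD1 (f a))//= (bigD1 (g a)) 1?eq_sym//= addrA lerDl.
  by apply: sumr_ge0 => b _; exact: abs2_ge0.
have F0 : 0 <= #|F|%:R :> R by [].
rewrite (split f) (split g) eg.
have := young (\sum_(a in E) y (a, f a)) (\sum_(a in ~: E) y (a, f a)).
have := young (\sum_(a in E) y (a, f a)) (\sum_(a in ~: E) y (a, g a)).
have := ler_wpM2l F0 tot.
have := bC f; have := bC g; lra.
Qed.

Lemma graph_avg_pair_le f g s (u : X -> R[i]) : (0 < #|F|)%N ->
  (4 * #|[set a | f a == g a]| <= #|F|)%N ->
  \sum_h abs2 (graph_avg f s u h) + \sum_h abs2 (graph_avg g s u h) <=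
  3 / 2 * \sum_h abs2 (u h).
Proof.
move=> F0 fg; rewrite !graph_avg_nsq// -mulrDr -big_split /=.
rewrite ler_pdivrMl ?ltr0n ?card_prod ?muln_gt0 ?F0//.
rewrite -card_prod mulrCA -(sum_upd s) mulr_sumr; apply: ler_sum => h _.
rewrite -mulrDr ler_pdivrMl ?ltr0n// mulrA [#|F|%:R * _]mulrC.
exact: (graph_pair_le (fun v => u (upd h s v)) fg).
Qed.

End Graphs.

(** * Choice of the labels *)

Section GoodLabels.
Variables (R : realType) (X : nat -> finType).
Notation blocknsq u m := (blocknsq X u m).

(** A trace bound: [bessel_coord] summed over the coordinates of the block. *)
Lemma sum_blocknsq_le (e : nat -> l2 R) (s : seq nat) m :
  Defs.orthonormal e -> uniq s ->
  \sum_(k <- s) blocknsq (e k) m <= #|X m|%:R.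
Proof.
move=> eo us; rewrite exchange_big /= -sum1_card natr_sum.
by apply: ler_sum => h _; exact: bessel_coord.
Qed.

(** Pigeonhole: if each label failed at some vector with mass at least [eps] in the block, these
    vectors would be distinct, and [#|L|] of them would violate the trace bound. *)
Lemma exists_good_label (L : finType) (q : L -> nat -> R) (e : nat -> l2 R) m
    (eps : R) :
  Defs.orthonormal e -> #|X m|%:R < eps * #|L|%:R ->
  (forall l l' k, l != l' -> q l k + q l' k <= 3 / 2 * blocknsq (e k) m) ->
  exists l, forall k, eps <= blocknsq (e k) m -> q l k <= 3 / 4 * blocknsq (e k) m.
Proof.
move=> eo XL qq; apply: contrapT => noL.
have /boolp.choice[k kP] l : exists k,
    eps <= blocknsq (e k) m /\ 3 / 4 * blocknsq (e k) m < q l k.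
  apply: contrapT => nok; apply: noL; exists l => k ek.
  by rewrite leNgt; apply/negP => qk; apply: nok; exists k.
(* Two labels failing at the same vector would together exceed 3/4 + 3/4 = 3/2 of its mass. *)
have kinj : injective k.
  move=> l l' kk; apply/eqP; apply: contraT => ll'.
  have := qq l l' (k l) ll'; have [_] := kP l; have [_] := kP l'.
  by rewrite -kk; lra.
have us : uniq [seq k l | l <- enum L] by rewrite map_inj_uniq ?enum_uniq.
have := sum_blocknsq_le m eo us.
rewrite big_map big_enum /=; apply/negP; rewrite -ltNge.
apply: lt_le_trans XL _; rewrite mulr_natr -sumr_const.
by apply: ler_sum => l _; case: (kP l).
Qed.

(** The total is at most 3/4 plus a quarter of the sum of all thresholds, which is below 1/4; this
    gives 13/16, less than 19/20. *)
Lemma avg_op_nsq_le (B : forall m, X m -> {set X m}) (hB : partial_partition B)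
    (x : l2 R) : nsq x <= 1 ->
  (forall m, 2 ^- m.+3 <= blocknsq x m ->
    blocknsq (avg B x) m <= 3 / 4 * blocknsq x m) ->
  nsq (avg_op hB x) <= 19 / 20.
Proof.
move=> x1 good; apply: nsq_le => n; apply: blocknsq_sum_le => [j|M].
  exact: avg_notin.
have geo N : \sum_(0 <= m < N) (2 ^- m.+3 : R) = 1 / 4 - 2 ^- N.+2.
  elim: N => [|N IH]; first by rewrite big_geq//; field.
  rewrite big_nat_recr//= IH !exprS; field.
  by rewrite expf_neq0.
apply: (@le_trans _ _ (\sum_(0 <= m < M) (3 / 4 * blocknsq x m + 1 / 4 * 2 ^- m.+3))).
  apply: ler_sum => m _; have e0 : 0 < 2 ^- m.+3 :> R by rewrite invr_gt0 exprn_gt0.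
  (* A heavy block satisfies the 3/4 bound; in a light block the remaining quarter of the mass is
     below a quarter of the threshold. *)
  have [/good|bad] := leP (2 ^- m.+3) (blocknsq x m).
    by move/le_trans; apply; rewrite lerDl mulr_ge0// ltW.
  by have := blocknsq_avg x m hB; lra.
rewrite big_split /= -!mulr_sumr geo.
have := blocknsq_nsq X M x.
have : 0 < 2 ^- M.+2 :> R by rewrite invr_gt0 exprn_gt0.
by lra.
Qed.

End GoodLabels.

(* A sequence of vectors is coded by the Dedekind cuts of all its coordinates. *)
Lemma sequence_code (R : realType) :
  exists code : (nat -> l2 R) -> nat -> bool, injective code.
Proof.
pose part (b : bool) (z : R[i]) := if b then complex.Re z else complex.Im z.
(* A bit is indexed by a vector [k], a coordinate [n], a choice [b] of real or imaginary part, and a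
   rational threshold [q]. *)
exists (fun e j => if unpickle j is Some (k, n, b, q)
                   then ratr q < part b (e k n) else false).
move=> e e' ee'; apply/funext => k; apply: l2_inj => n.
have cut b q : (ratr q < part b (e k n)) = (ratr q < part b (e' k n)).
  by have := congr1 (fun f => f (pickle (k, n, b, q : rat))) ee'; rewrite /= pickleK.
have parts b : part b (e k n) = part b (e' k n).
  apply/eqP; rewrite eq_le; apply/andP; split; rewrite leNgt; apply/negP.
    move=> /rat_in_itvoo[q]; rewrite in_itv/= => /andP[q1 q2].
    by move: q2; rewrite cut ltNge (ltW q1).
  move=> /rat_in_itvoo[q]; rewrite in_itv/= => /andP[q1 q2].
  by move: q2; rewrite -cut ltNge (ltW q1).
have := parts true; have := parts false; rewrite /part.
by case: (e k n) (e' k n) => [a b] [c d] /= -> ->.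
Qed.

(** * Parameters of the blocks: prime fields and polynomial labels *)

Definition code_dim n : nat := 2 * 2 ^ n + n + 4.

(** The factor 4 ensures that distinct polynomials of degree below [code_dim n] agree on at most a
    quarter of the field. *)
Definition field_size n : nat := s2val (prime_above (4 * code_dim n)).

(* The index [s] of a factor is a word of length [n]; its basis vectors are the
   points of the plane over the prime field. *)
Definition word_index n : finType :=
  {ffun n.-tuple bool -> 'F_(field_size n) * 'F_(field_size n)}.

Definition label n : finType := 'rV['F_(field_size n)]_(code_dim n).

Definition label_fun n (l : label n) (a : 'F_(field_size n)) := (rVpoly l).[a].

Lemma card_field n : #|'F_(field_size n)| = field_size n.
Proof. by rewrite card_Fp// /field_size; case: prime_above. Qed.

Lemma field_size_gt n : (4 * code_dim n < field_size n)%N.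
Proof. by rewrite /field_size; case: prime_above. Qed.

(** Agreement points are roots of the nonzero polynomial [rVpoly (l - l')], which has fewer than
    [code_dim n] of them. *)
Lemma card_agree n (l l' : label n) : l != l' ->
  (4 * #|[set a | label_fun l a == label_fun l' a]%SET| <= #|'F_(field_size n)|)%N.
Proof.
move=> ll'; rewrite card_field; apply: leq_trans (ltnW (field_size_gt n)).
rewrite leq_mul2l /=.
have P0 : rVpoly (l - l') != 0.
  apply: contra_neq ll' => P0; apply/eqP; rewrite -subr_eq0; apply/eqP.
  by apply: (can_inj rVpolyK); rewrite P0 linear0.
set A := [set a | _]%SET.
have : (size (enum A) < size (rVpoly (l - l')))%N.
  apply: max_poly_roots => //; last exact: enum_uniq.
  apply/allP => a; rewrite mem_enum inE => /eqP e.
  by rewrite rootE linearB/= hornerD hornerN [X in X - _]e subrr.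
by rewrite -cardE => /ltnW/leq_trans; apply; exact: size_poly.
Qed.

(** The dimension is p^(2 * 2^n) and the number of labels is p^(2 * 2^n + n + 4); the extra n + 4 in
    [code_dim] beats the inverse threshold 2^(n+3). *)
Lemma card_word_index_lt n : (2 ^ n.+3 * #|word_index n| < #|label n|)%N.
Proof.
rewrite card_ffun card_prod card_mx mul1n card_tuple card_bool card_field.
set p := field_size n; have p2 : (2 < p)%N.
  apply: leq_trans (field_size_gt n); rewrite ltnS /code_dim.
  by rewrite addn4 !mulnS.
have p0 : (0 < p)%N by apply: leq_trans p2.
rewrite mulnn -expnM /code_dim -addnA expnD mulnC ltn_pmul2l ?expn_gt0 ?p0//.
apply: (@leq_ltn_trans (p ^ n.+3)%N).
  by rewrite leq_exp2r// ltnW.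
by rewrite ltn_exp2l ?addn4//; exact: ltn_trans p2.
Qed.

(** * The projection of a binary sequence with a polynomial chosen in each block *)

Section Construction.
Variable R : realType.
Notation choice_fun := (forall n, label n).
Implicit Types (al : nat -> bool) (phi : choice_fun).

Definition prefix al n : n.-tuple bool := [tuple al i | i < n].

Definition player_cell al phi n (h : word_index n) : {set word_index n} :=
  graph_cell (label_fun (phi n)) (prefix al n) h.

Lemma player_cell_partition al phi : partial_partition (player_cell al phi).
Proof. by move=> n h h'; exact: graph_cellP. Qed.

Lemma blocknsq_player al phi (u : nat -> R[i]) n :
  blocknsq word_index (avg (player_cell al phi) u) n =
  \sum_h abs2 (graph_avg (label_fun (phi n)) (prefix al n) (fun h => u (@idx word_index n h)) h).
Proof. by apply: eq_bigr => h _; rewrite avg_idx. Qed.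

(** Labels are chosen block by block; in each block a single label serves all the vectors that are
    heavy there. *)
Lemma exists_good_choice al (e : nat -> l2 R) : Defs.orthonormal e ->
  exists phi, forall k, nsq (avg_op (@player_cell_partition al phi) (e k)) <= 19 / 20.
Proof.
move=> eo.
have lab n : exists l : label n, forall k,
    2 ^- n.+3 <= blocknsq word_index (e k) n ->
    \sum_h abs2 (graph_avg (label_fun l) (prefix al n) (fun h => e k (@idx word_index n h)) h)
      <= 3 / 4 * blocknsq word_index (e k) n.
  apply: (exists_good_label (q := fun l k => \sum_h abs2
    (graph_avg (label_fun l) (prefix al n) (fun h => e k (@idx word_index n h)) h))) => //.
    rewrite mulrC ltr_pdivlMr ?exprn_gt0// -natrX -natrM ltr_nat mulnC.
    exact: card_word_index_lt.
  move=> l l' k ll'; apply: graph_avg_pair_le; last exact: card_agree.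
  by rewrite card_field; apply: leq_ltn_trans (field_size_gt n).
exists (fun n => sval (cid (lab n))) => k; apply: avg_op_nsq_le.
  by have := inner_xx (e k); rewrite eo eqxx => -[<-].
by move=> n; rewrite blocknsq_player; case: cid => l /=; exact.
Qed.

Lemma player_cell_infinite al phi :
  ~ finite_dimensional (range (avg_op (R := R) (@player_cell_partition al phi))).
Proof.
apply: avg_op_infinite => n.
(* Any word whose coordinate at the prefix lies on the graph would do; here all coordinates are that
   point. *)
exists [ffun=> (0, label_fun (phi n) 0)].
by rewrite /player_cell graph_cell_mem ffunE.
Qed.

(** [Q] lives in one block, long enough to separate the distinct sequences, and projects onto the
    product of one graph per factor. Repeated sequences cause no conflict, since [phi] depends on
    the sequence only. *)
Lemma common_projection n (a : 'I_n -> nat -> bool) (phi : (nat -> bool) -> choice_fun) :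
  exists Q : {linear l2 R -> l2 R},
    [/\ orthogonal_projection Q, exists x, Q x <> 0 &
        forall i, proj_le Q (avg_op (@player_cell_partition (a i) (phi (a i))))].
Proof.
have /boolp.choice[w wP] (ij : 'I_n * 'I_n) :
    exists m, a ij.1 = a ij.2 \/ a ij.1 m <> a ij.2 m.
  have [|ne] := pselect (a ij.1 = a ij.2); first by exists 0; left.
  apply: contrapT => no; apply: ne; apply/funext => m.
  by apply: contrapT => am; apply: no; exists m; right.
(* The successor puts every separating position inside the prefix of length [N]. *)
pose N := (\max_ij w ij).+1.
have prefN i j : prefix (a i) N = prefix (a j) N -> a i = a j.
  move=> e; have [//|] := wP (i, j); case.
  have wN : (w (i, j) < N)%N by rewrite ltnS leq_bigmax.
  by have := congr1 (fun t => tnth t (Ordinal wN)) e; rewrite !tnth_mktuple.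
(* The graph for the factor [s]: prescribed if some sequence uses this factor, otherwise that of the
   zero polynomial. At length [N] the pick is unambiguous by [prefN]. *)
pose G m (s : m.-tuple bool) : label m :=
  if [pick i | prefix (a i) m == s] is Some i then phi (a i) m else 0.
have GN i : G N (prefix (a i) N) = phi (a i) N.
  rewrite /G; case: pickP => [j /eqP/prefN ->//|/(_ i)].
  by rewrite eqxx.
pose P m (h : word_index m) : bool :=
  [forall s, (h s).2 == label_fun (G m s) (h s).1].
pose D m (h : word_index m) : {set word_index m} :=
  if (m == N) && P m h then [set h' | P m h']%SET else finset.set0.
have hD : partial_partition D.
  move=> m h h'; rewrite /D; case: ifP => [/andP[mN Ph]|]; last by rewrite inE.
  by rewrite !inE mN /= => Ph'; rewrite Ph Ph'.
have in_graph i (h : word_index N) : P N h -> h \in player_cell (a i) (phi (a i)) h.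
  by move=> /forallP/(_ (prefix (a i) N)); rewrite /player_cell graph_cell_mem GN.
exists (avg_op hD); split; first exact: avg_op_projection.
  pose h0 : word_index N := [ffun s => (0, label_fun (G N s) 0)].
  have Ph0 : P N h0 by apply/forallP => s; rewrite ffunE.
  exists (@cell_indic R word_index N (D N h0)).
  rewrite [X in X <> _](@avg_op_cell_indic R word_index D hD N h0).
  move=> /(congr1 (fun x : l2 R => x (@idx word_index N h0))).
  rewrite cell_indicE /D eqxx Ph0 inE Ph0 => /eqP.
  by rewrite oner_eq0.
move=> i _ [x _ <-]; exists (avg_op hD x) => //; apply: avg_op_absorb.
  move=> m h h' h'h; rewrite /D; have [mN|//] := eqVneq m N.
  subst m; rewrite /=; suff -> : P N h' = P N h by [].
  (* Moving along the prescribed graph in one factor leaves the other coordinates alone, so the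
     product of graphs is preserved. *)
  have sub (h1 h2 : word_index N) : h2 \in player_cell (a i) (phi (a i)) h1 ->
      P N h1 -> P N h2.
    rewrite /player_cell /graph_cell; case: ifP => [_|]; last by rewrite inE.
    move=> /imsetP[b _ ->] /forallP Ph1; apply/forallP => s.
    by rewrite ffunE; have [->|_] := eqVneq s (prefix (a i) N); rewrite ?GN.
  have [hh e] := player_cell_partition h'h.
  by apply/idP/idP; apply: sub => //; rewrite e.
move=> m h; rewrite /D; have [mN|//] := eqVneq m N.
subst m; rewrite /=; case: ifP => // /(in_graph i) + B0.
by rewrite B0 inE.
Qed.

End Construction.

Theorem theorem10 (R : realType) :
  exists P : (nat -> bool) -> {linear l2 R -> l2 R},
    [/\ forall a, orthogonal_projection (P a) /\
                  ~ finite_dimensional (range (P a)),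
        forall (n : nat) (a : 'I_n -> (nat -> bool)),
          exists Q : {linear l2 R -> l2 R},
            [/\ orthogonal_projection Q, exists x, Q x <> 0 &
                forall i, proj_le Q (P (a i))] &
        forall e : nat -> l2 R, orthonormal_basis e ->
          exists a : nat -> bool,
            forall k, `|inner (P a (e k)) (e k)| <= 19%:R / 20%:R].
Proof.
have [code code_inj] := sequence_code R.
(* A sequence codes at most one [e], so its polynomials can be adapted to that [e]; sequences coding
   no orthonormal sequence get the zero labels. *)
have /boolp.choice[phi phiP] (a : nat -> bool) : exists phi : forall n, label n,
    forall e : nat -> l2 R, Defs.orthonormal e -> code e = a ->
    forall k, nsq (avg_op (@player_cell_partition a phi) (e k)) <= 19 / 20.
  have [[e [eo ea]]|no] := pselect (exists e, Defs.orthonormal e /\ code e = a).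
    have [phi phiP] := exists_good_choice a eo.
    by exists phi => e' _ e'a; rewrite -ea in e'a; rewrite (code_inj _ _ e'a).
  by exists (fun=> 0) => e eo ea; case: no; exists e.
exists (fun a => avg_op (@player_cell_partition a (phi a))); split.
- by move=> a; split; [exact: avg_op_projection|exact: player_cell_infinite].
- by move=> n a; exact: common_projection.
move=> e [eo _]; exists (code e) => k.
set P := avg_op _.
have [_ PP Psa] : orthogonal_projection P by exact: avg_op_projection.
(* Idempotence and self-adjointness turn the diagonal entry into the squared norm of [P (e k)], a
   nonnegative real. *)
rewrite -PP Psa inner_xx normc_def /= expr0n /= addr0 sqrtr_sqr ger0_norm ?nsq_ge0//.
have -> : 19%:R / 20%:R = (19 / 20)%:C :> R[i] by rewrite rmorphM fmorphV !rmorph_nat.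
by rewrite lecR phiP.
Qed.
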